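(* Let $\mathbf{S}=\{p^n : n\in\mathbb{Z}\}$ be a cyclic transformation group over the set $X$, where $p$ is a permutation of $X$ comprising a single cycle. Then $\mathbf{S}$ has an unrepresentation.
   Context: $\mathbf{S}$ is regarded as a subsemigroup of $(\mathrm{End}(X),\circ)$, where $\mathrm{End}(X)$ is the set of all functions $X\to X$. The permutation $p$ of $X$ comprises a single cycle if $X$ is non-empty and for all $z,x\in X$ there is an integer $k$ with $x=p^k(z)$. For a semigroup $\mathbf{X}=(X,\cdot)$ the representing map is $\phi_{\mathbf{X}}\colon X\to\mathrm{End}(X)$, $\phi_{\mathbf{X}}(x)(y)=x\cdot y$; its image is the representation of $\mathbf{X}$, and $\mathbf{X}$ is faithful if $\phi_{\mathbf{X}}$ is injective. An unrepresentation of $\mathbf{S}$ is a faithful semigroup with underlying set $X$ whose representation is $\mathbf{S}$. *)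

(* Defs.v *)
From mathcomp Require Import all_boot all_algebra.
From mathcomp Require Import boolp classical_sets functions.

Set Implicit Arguments.
Unset Strict Implicit.
Unset Printing Implicit Defensive.

Local Open Scope classical_set_scope.

(* End(X) is the function type X -> X under \o. A transformation semigroup over
   X is given by its set of elements, its product being the inherited one.
   A permutation of X is an element of {splitbij [set: X] >-> [set: X]}: a
   function bundled with its (unique) two-sided inverse p^-1. *)

Section Permutation.
Variables (X : Type) (p : {splitbij [set: X] >-> [set: X]}).

Definition perm_exp (k : int) : X -> X :=
  match k with
  | Posz n => iter n p
  | Negz n => iter n.+1 (p^-1)%FUN (* Negz n is the integer - n.+1 *)
  end.

Definition single_cycle : Prop :=
  [set: X] !=set0 /\ forall z x : X, exists k : int, x = perm_exp k z.

Definition cyclic_transformation_group : set (X -> X) :=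
  [set perm_exp k | k in [set: int]].

End Permutation.

Section Unrepresentation.
Variable X : Type.

(* SemiGroup.law X is the type of associative binary operations on X, that is,
   of semigroups with underlying set X. *)
Implicit Type op : SemiGroup.law X.

Definition representing_map op : X -> (X -> X) := fun x y => op x y.

Definition representation op : set (X -> X) :=
  [set representing_map op x | x in [set: X]].

Definition faithful op : Prop := injective (representing_map op).

Definition unrepresentation (S : set (X -> X)) op : Prop :=
  faithful op /\ representation op = S.

End Unrepresentation.

(* Main.v *)
Require Import Defs.
From HB Require Import structures.
From mathcomp Require Import all_boot all_algebra.
From mathcomp Require Import boolp classical_sets functions.

(** The powers of [p] commute pairwise and, [p] having a single cycle, carry a
    fixed point [z] to every point of [X].  Two elements of such a commuting
    family that agree at [z] agree everywhere, so [x |-> (the element mapping z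
    to x)] is a bijection from [X] onto the family; multiplying [x] by [y] means
    applying the element attached to [x] to [y]. *)

Local Open Scope classical_set_scope.

Lemma iter_commute {T : Type} {f g : T -> T} (m n : nat) :
  (forall x, f (g x) = g (f x)) ->
  forall x, iter m f (iter n g x) = iter n g (iter m f x).
Proof.
move=> fg; have fgn x : f (iter n g x) = iter n g (f x).
  by elim: n => //= n <-; rewrite fg.
by elim: m => //= m IHm x; rewrite IHm fgn.
Qed.

(** Since [p] commutes with [p^-1], every combination of signs reduces to iterates of two commuting
    maps. *)
Lemma perm_exp_commute {X : Type} (p : {splitbij [set: X] >-> [set: X]})
    (j k : int) (x : X) :
  perm_exp p j (perm_exp p k x) = perm_exp p k (perm_exp p j x).
Proof.
have pV y : p ((p^-1)%FUN y) = (p^-1)%FUN (p y).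
  by rewrite funK ?invK ?inE.
by case: j k => [m|m] [n|n]; apply: iter_commute.
Qed.

Lemma commuting_unrepresentation (X : Type) (S : set (X -> X)) (z : X) :
  (forall f g, S f -> S g -> forall x, f (g x) = g (f x)) ->
  (forall x, exists2 f, S f & f z = x) ->
  exists op : SemiGroup.law X, unrepresentation S op.
Proof.
move=> comS transS.
pose t x : X -> X := sval (cid2 (transS x)).
have tS x : S (t x) by rewrite /t; case: cid2.
have tz x : t x z = x by rewrite /t; case: cid2.
have eqS f g : S f -> S g -> f z = g z -> f = g.
  move=> Sf Sg fgz; apply: funext => x.
  (* With [x] written as [t x z], commuting gives [f x = t x (f z)], and likewise for [g]. *)
  by rewrite -(tz x) (comS _ _ Sf) // fgz (comS _ _ Sg).
have tA : associative t.
  (* Writing [w] as [t w z] and moving [t w] outermost turns both sides into [t w (t x y)]. *)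
  move=> x y w; rewrite -(tz w) !(comS _ (t w)) //.
  by rewrite !tz.
pose opM := SemiGroup.isLaw.Build X t tA.
pose op : SemiGroup.law X := HB.pack t opM.
exists op; split=> [x y txy|].
  by rewrite -(tz x) -(tz y); exact: (congr1 (@^~ z) txy).
apply/seteqP; split=> [_ [x _ <-]|f Sf]; first exact: tS.
(* [f] and [t (f z)] both send [z] to [f z]. *)
by exists (f z) => //; apply: eqS => //; exact: tz.
Qed.

Theorem proposition3p12 (X : Type) (p : {splitbij [set: X] >-> [set: X]}) :
  single_cycle p ->
  exists op : SemiGroup.law X,
    unrepresentation (cyclic_transformation_group p) op.
Proof.
case=> -[z _] cyc; apply: (@commuting_unrepresentation _ _ z).
  by move=> _ _ [j _ <-] [k _ <-] x; exact: perm_exp_commute.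
by move=> x; have [k ->] := cyc z x; exists (perm_exp p k) => //; exists k.
Qed.
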